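(* Let $\widehat{A}=A+\varepsilon B$ be an $n\times n$ dual matrix with $A,B\in\mathbb{R}^{n\times n}$. Then the dual core generalized inverse of $\widehat{A}$ exists if and only if $\mathrm{Ind}(A)=1$ and $(I_n-AA^{+})B(I_n-AA^{\#})=0$.
   Context: Dual numbers are $a+\varepsilon a'$ with $a,a'\in\mathbb{R}$ and $\varepsilon\neq 0$, $\varepsilon^2=0$ (i.e. the ring $\mathbb{R}[\varepsilon]/(\varepsilon^2)$). A dual matrix is a matrix over dual numbers, written $\widehat{A}=A+\varepsilon B$ with $A,B$ real; its transpose is $\widehat{A}^{T}=A^{T}+\varepsilon B^{T}$. The dual core generalized inverse (DCGI) of an $n\times n$ dual matrix $\widehat{A}$ is an $n\times n$ dual matrix $\widehat{G}$ with $\widehat{A}\widehat{G}\widehat{A}=\widehat{A}$, $\widehat{A}\widehat{G}^2=\widehat{G}$, $(\widehat{A}\widehat{G})^{T}=\widehat{A}\widehat{G}$; it may or may not exist. For a real square matrix $A$, ''$\mathrm{Ind}(A)=1$'' means $\mathrm{rank}(A^2)=\mathrm{rank}(A)$; in that case $A^{\#}$ denotes the group inverse of $A$ (the unique real $X$ with $AXA=A$, $XAX=X$, $AX=XA$). $A^{+}$ is the real Moore–Penrose inverse of $A$. *)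

(* Defs.v *)
From HB Require Import structures.
From mathcomp Require Import all_boot all_order all_algebra.
From mathcomp Require Import boolp classical_sets reals.

Set Implicit Arguments.
Unset Strict Implicit.
Unset Printing Implicit Defensive.

Import Order.TTheory GRing.Theory Num.Theory.
Local Open Scope ring_scope.

(* [Dual a a'] is a + eps a'. *)
Record dual (R : Type) : Type := Dual { dual_st : R; dual_inf : R }.

Definition pair_of_dual (R : Type) (x : dual R) : R * R :=
  (dual_st x, dual_inf x).
Definition dual_of_pair (R : Type) (p : R * R) : dual R := Dual p.1 p.2.

Lemma pair_of_dualK (R : Type) : cancel (@pair_of_dual R) (@dual_of_pair R).
Proof. by case. Qed.

HB.instance Definition _ (R : eqType) :=
  Equality.copy (dual R) (can_type (@pair_of_dualK R)).
HB.instance Definition _ (R : choiceType) :=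
  Choice.copy (dual R) (can_type (@pair_of_dualK R)).

Section DualRing.
Variable R : comNzRingType.
Implicit Types x y z : dual R.

Definition dual_zero : dual R := Dual 0 0.
Definition dual_one : dual R := Dual 1 0.
Definition dual_opp x : dual R := Dual (- dual_st x) (- dual_inf x).
Definition dual_add x y : dual R :=
  Dual (dual_st x + dual_st y) (dual_inf x + dual_inf y).
Definition dual_mul x y : dual R :=
  Dual (dual_st x * dual_st y) (dual_st x * dual_inf y + dual_inf x * dual_st y).

Lemma dual_addA : associative dual_add.
Proof. by move=> [? ?] [? ?] [? ?]; rewrite /dual_add /= !addrA. Qed.
Lemma dual_addC : commutative dual_add.
Proof. by move=> [a a'] [b b']; rewrite /dual_add /= (addrC a) (addrC a'). Qed.
Lemma dual_add0 : left_id dual_zero dual_add.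
Proof. by move=> [? ?]; rewrite /dual_add /= !add0r. Qed.
Lemma dual_addN : left_inverse dual_zero dual_opp dual_add.
Proof. by move=> [? ?]; rewrite /dual_add /= !addNr. Qed.

HB.instance Definition _ :=
  GRing.isZmodule.Build (dual R) dual_addA dual_addC dual_add0 dual_addN.

Lemma dual_mulA : associative dual_mul.
Proof.
by move=> [? ?] [? ?] [? ?]; rewrite /dual_mul /= !mulrDr !mulrDl !mulrA !addrA.
Qed.
Lemma dual_mulC : commutative dual_mul.
Proof.
move=> [a a'] [b b']; rewrite /dual_mul /= (mulrC a b) addrC.
by rewrite (mulrC a') (mulrC a).
Qed.
Lemma dual_mul1 : left_id dual_one dual_mul.
Proof. by move=> [? ?]; rewrite /dual_mul /= !mul1r mul0r addr0. Qed.
Lemma dual_mulDl : left_distributive dual_mul dual_add.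
Proof.
by move=> [? ?] [? ?] [? ?]; rewrite /dual_mul /dual_add /= !mulrDl addrACA.
Qed.
Lemma dual_one_neq0 : dual_one != 0 :> dual R.
Proof. by apply/eqP => -[] /eqP; rewrite oner_eq0. Qed.

HB.instance Definition _ := GRing.Zmodule_isComNzRing.Build (dual R)
  dual_mulA dual_mulC dual_mul1 dual_mulDl dual_one_neq0.

Definition dual_real (a : R) : dual R := Dual a 0.
Definition eps : dual R := Dual 0 1.

Lemma eps_neq0 : eps != 0.
Proof. by apply/eqP => -[] /eqP; rewrite oner_eq0. Qed.

Lemma eps_sqr : eps ^+ 2 = 0.
Proof. by congr Dual; rewrite /= ?mul0r ?mulr0 ?addr0. Qed.

Lemma DualE (a a' : R) : Dual a a' = dual_real a + eps * dual_real a'.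
Proof. by congr Dual; rewrite /= ?mul0r ?addr0 ?add0r ?mul1r. Qed.

Definition dual_mx m n (A B : 'M[R]_(m, n)) : 'M[dual R]_(m, n) :=
  map_mx dual_real A + eps *: map_mx dual_real B.

Lemma dual_mxE m n (A B : 'M[R]_(m, n)) i j :
  dual_mx A B i j = Dual (A i j) (B i j).
Proof. by rewrite !mxE -DualE. Qed.

Lemma tr_dual_mx m n (A B : 'M[R]_(m, n)) : (dual_mx A B)^T = dual_mx A^T B^T.
Proof. by apply/matrixP => i j; rewrite mxE !dual_mxE !mxE. Qed.

Lemma mul_dual_mx m n p (A B : 'M[R]_(m, n)) (C D : 'M[R]_(n, p)) :
  dual_mx A B *m dual_mx C D = dual_mx (A *m C) (A *m D + B *m C).
Proof.
apply/matrixP => i j; rewrite dual_mxE !mxE -big_split /=.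
elim/big_ind3: _ => //= [_ a b _ c d -> ->|k _] //.
by rewrite !dual_mxE.
Qed.

Definition is_dcgi n (A G : 'M[dual R]_n) : Prop :=
  [/\ A *m G *m A = A, A *m (G *m G) = G & (A *m G)^T = A *m G].

End DualRing.

Arguments eps {R}.

Definition index_one (F : fieldType) n (A : 'M[F]_n) : Prop :=
  \rank (A *m A) = \rank A.

Definition is_group_inverse (F : fieldType) n (A X : 'M[F]_n) : Prop :=
  [/\ A *m X *m A = A, X *m A *m X = X & A *m X = X *m A].

Definition is_mp_inverse (F : fieldType) m n (A : 'M[F]_(m, n))
    (X : 'M[F]_(n, m)) : Prop :=
  [/\ A *m X *m A = A, X *m A *m X = X, (A *m X)^T = A *m X
    & (X *m A)^T = X *m A].

(* The value is 0 when A has no group inverse; see [group_invP]. *)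
Definition group_inv (F : fieldType) n (A : 'M[F]_n) : 'M[F]_n :=
  xget 0 [set X | is_group_inverse A X].

(* Over a real field the inverse always exists; see [mp_invP]. *)
Definition mp_inv (F : fieldType) m n (A : 'M[F]_(m, n)) : 'M[F]_(n, m) :=
  xget 0 [set X | is_mp_inverse A X].

Lemma is_group_inverse_uniq (F : fieldType) n (A X Y : 'M[F]_n) :
  is_group_inverse A X -> is_group_inverse A Y -> X = Y.
Proof.
move=> [AXA XAX cX] [AYA YAY cY].
have e : A *m X = A *m Y.
  by rewrite cX -[in LHS]AYA -mulmxA -cY !mulmxA -cX AXA.
by rewrite -XAX -mulmxA e mulmxA -cX e cY YAY.
Qed.

Lemma full_rank_factorization (F : fieldType) m n (A : 'M[F]_(m, n)) :
  exists r (C : 'M[F]_(m, r)) (D : 'M[F]_(r, n)),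
    [/\ A = C *m D, \rank A = r, row_full C & row_free D].
Proof.
exists (\rank A), (col_base A), (row_base A).
by split; rewrite ?mulmx_base ?col_base_full ?row_base_free.
Qed.

Lemma group_inverse_ex (F : fieldType) n (A : 'M[F]_n) :
  index_one A -> exists X, is_group_inverse A X.
Proof.
rewrite /index_one.
have [r [C [D [-> -> _ _]]]] := full_rank_factorization A => rA.
have uDC : D *m C \in unitmx.
  rewrite -row_free_unit; apply/eqnP; apply/anti_leq; rewrite rank_leq_row /=.
  rewrite -{1}rA mulmxA -(mulmxA C).
  exact: leq_trans (mxrankM_maxl _ _) (mxrankM_maxr _ _).
pose W := invmx (D *m C); exists (C *m W *m W *m D).
have DCW k (Z : 'M_(r, k)) : D *m (C *m (W *m Z)) = Z.
  by rewrite !mulmxA mulmxV ?mul1mx.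
have WDC k (Z : 'M_(r, k)) : W *m (D *m (C *m Z)) = Z.
  by rewrite (mulmxA D) mulmxA mulVmx ?mul1mx.
by split; rewrite -!mulmxA ?DCW ?WDC ?DCW.
Qed.

Lemma group_invP (F : fieldType) n (A : 'M[F]_n) :
  index_one A -> is_group_inverse A (group_inv A).
Proof. by move=> /group_inverse_ex/(xgetPex 0). Qed.

Lemma is_mp_inverse_uniq (F : fieldType) m n (A : 'M[F]_(m, n)) X Y :
  is_mp_inverse A X -> is_mp_inverse A Y -> X = Y.
Proof.
move=> [AXA XAX sAX sXA] [AYA YAY sAY sYA].
have e1 : A *m X = A *m Y.
  by rewrite -sAX -{1}AYA -(mulmxA (A *m Y)) trmx_mul sAX sAY mulmxA AXA.
have e2 : X *m A = Y *m A.
  by rewrite -sXA -{1}AYA !mulmxA -(mulmxA (X *m A)) trmx_mul sXA sYA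
             -!mulmxA (mulmxA A) AXA.
by rewrite -XAX e2 -mulmxA e1 mulmxA YAY.
Qed.

Lemma gram_unitmx (F : realFieldType) m n (D : 'M[F]_(m, n)) :
  row_free D -> D *m D^T \in unitmx.
Proof.
move=> fD; rewrite -row_free_unit; apply: inj_row_free => v vDD0.
suff vD0 : v *m D = 0 by apply: (row_free_inj fD); rewrite vD0 mul0mx.
have : (v *m D) *m (v *m D)^T = 0 by rewrite trmx_mul mulmxA -(mulmxA v) vDD0 mul0mx.
move/matrixP/(_ 0 0); rewrite !mxE => s0; apply/rowP => k; rewrite [RHS]mxE.
have sq j : (v *m D) 0 j * (v *m D)^T j 0 = (v *m D) 0 j ^+ 2.
  by rewrite [_^T _ _]mxE expr2.
have /psumr_eq0P/(_ s0 k isT)/eqP : forall j : 'I_n, true ->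
    0 <= (v *m D) 0 j * (v *m D)^T j 0 by move=> j _; rewrite sq sqr_ge0.
by rewrite sq sqrf_eq0 => /eqP.
Qed.

Lemma mp_inverse_ex (F : realFieldType) m n (A : 'M[F]_(m, n)) :
  exists X, is_mp_inverse A X.
Proof.
have [r [C [D [-> _ fC fD]]]] := full_rank_factorization A.
have uD : D *m D^T \in unitmx by apply: gram_unitmx.
have uC : C^T *m C \in unitmx.
  by rewrite -{2}(trmxK C) gram_unitmx // /row_free mxrank_tr.
pose P := invmx (D *m D^T); pose Q := invmx (C^T *m C).
have PT : P^T = P by rewrite trmx_inv trmx_mul trmxK.
have QT : Q^T = Q by rewrite trmx_inv trmx_mul trmxK.
exists (D^T *m P *m Q *m C^T).
have DP k (Z : 'M_(r, k)) : D *m (D^T *m (P *m Z)) = Z.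
  by rewrite !mulmxA mulmxV ?mul1mx.
have QC k (Z : 'M_(r, k)) : Q *m (C^T *m (C *m Z)) = Z.
  by rewrite (mulmxA C^T) mulmxA mulVmx ?mul1mx.
split; rewrite -!mulmxA ?DP ?QC ?DP //.
- by rewrite !trmx_mul trmxK QT -mulmxA.
- by rewrite !trmx_mul trmxK PT -mulmxA.
Qed.

Lemma mp_invP (F : realFieldType) m n (A : 'M[F]_(m, n)) :
  is_mp_inverse A (mp_inv A).
Proof. exact: (xgetPex 0 (mp_inverse_ex A)). Qed.

(* Main.v *)
Require Import Defs.
From mathcomp Require Import all_boot all_order all_algebra.
From mathcomp Require Import reals.

(** If the dual core inverse exists, compressing the infinitesimal part of
    [A^ G A^ = A^] by the annihilators I - A A^+ and I - A A^# leaves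
    (I - A A^+) B (I - A A^#) = 0.  Conversely, that condition says
    B = U A + A V with V = A^+ B and U = (I - A A^+) B A^#, so a full rank
    factorization A = C D lifts to A^ = (C + eps U C) (D + eps D V) = C^ D^.
    Invertibility of dual matrices only depends on the standard part, hence
    D^ C^ and C^^T C^ are invertible, and
    C^ (D^ C^)^-1 (C^^T C^)^-1 C^^T is the core inverse. *)

Import GRing.Theory.

Local Open Scope ring_scope.

Lemma dual_mx_surj (R : comNzRingType) (m n : nat) (M : 'M[dual R]_(m, n)) :
  exists X Y, M = dual_mx X Y.
Proof.
exists (map_mx (@dual_st R) M), (map_mx (@dual_inf R) M).
by apply/matrixP => i j; rewrite dual_mxE !mxE; case: (M i j).
Qed.

Lemma dual_mx_inj (R : comNzRingType) (m n : nat) (A B C D : 'M[R]_(m, n)) :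
  dual_mx A B = dual_mx C D -> A = C /\ B = D.
Proof.
move=> /matrixP e.
have e' i j : Dual (A i j) (B i j) = Dual (C i j) (D i j).
  exact: etrans (esym (dual_mxE A B i j)) (etrans (e i j) (dual_mxE C D i j)).
split; apply/matrixP => i j.
- by case: (e' i j).
- by case: (e' i j).
Qed.

Lemma dual_mx1 (R : comNzRingType) (n : nat) :
  dual_mx 1%:M 0 = 1%:M :> 'M[dual R]_n.
Proof. by apply/matrixP => i j; rewrite dual_mxE !mxE; case: (i == j). Qed.

Lemma dual_mx_inverse (F : fieldType) (n : nat) (M N : 'M[F]_n) :
  M \in unitmx ->
  exists2 W : 'M[dual F]_n,
    dual_mx M N *m W = 1%:M & W *m dual_mx M N = 1%:M.
Proof.
(* The geometric series for [(M + eps N)^-1], which stops after the linear term because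
   [eps ^+ 2 = 0]. *)
move=> uM; exists (dual_mx (invmx M) (- (invmx M *m N *m invmx M)));
  rewrite mul_dual_mx -dual_mx1; congr dual_mx.
- exact: mulmxV.
- by rewrite mulmxN !mulmxA (mulmxV uM) mul1mx addNr.
- exact: mulVmx.
- by rewrite mulNmx -!mulmxA (mulVmx uM) mulmx1 subrr.
Qed.

(** [A *m G] collapses to [C *m K *m C^T], which fixes [C] and is symmetric because [K] inverts a
    symmetric Gram matrix. Stated over any commutative ring so that it applies to dual numbers. *)
Lemma full_rank_core_inverse (S : comNzRingType) (n r : nat) (C : 'M[S]_(n, r))
    (D : 'M[S]_(r, n)) (W K : 'M[S]_r) :
  D *m C *m W = 1%:M ->
  C^T *m C *m K = 1%:M -> K *m (C^T *m C) = 1%:M ->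
  let A := C *m D in let G := C *m W *m K *m C^T in
  [/\ A *m G *m A = A, A *m (G *m G) = G & (A *m G)^T = A *m G].
Proof.
move=> DCW CCK KCC A G; rewrite {}/A {}/G.
have KT : K^T = K.
  rewrite -[K^T]mulmx1 -CCK mulmxA.
  have -> : K^T *m (C^T *m C) = 1%:M.
    have GT : (C^T *m C)^T = C^T *m C by rewrite trmx_mul trmxK.
    by rewrite -GT -trmx_mul CCK trmx1.
  by rewrite mul1mx.
have AG : C *m D *m (C *m W *m K *m C^T) = C *m K *m C^T.
  by rewrite !mulmxA -(mulmxA C D C) -(mulmxA C _ W) DCW mulmx1.
have AGC : C *m K *m C^T *m C = C by rewrite -!mulmxA KCC mulmx1.
split; rewrite ?mulmxA in AG AGC *.
- by rewrite AG AGC.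
- by rewrite AG AGC.
- by rewrite AG !trmx_mul trmxK KT mulmxA.
Qed.

(** The square of [C *m D] is [C *m (D *m C) *m D], so its rank [r] bounds that of the [r] by [r]
    matrix [D *m C] from below. *)
Lemma index_one_factor_unit (F : fieldType) (n r : nat) (C : 'M[F]_(n, r))
    (D : 'M[F]_(r, n)) :
  index_one (C *m D) -> \rank (C *m D) = r -> D *m C \in unitmx.
Proof.
move=> iA rA; rewrite -row_free_unit; apply/eqnP/anti_leq.
rewrite rank_leq_row /= -{1}rA -iA mulmxA -(mulmxA C).
exact: leq_trans (mxrankM_maxl _ _) (mxrankM_maxr _ _).
Qed.

Lemma gram_unitmx_full (F : realFieldType) (m n : nat) (C : 'M[F]_(m, n)) :
  row_full C -> C^T *m C \in unitmx.
Proof.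
by move=> fC; rewrite -{2}(trmxK C) gram_unitmx // /row_free mxrank_tr.
Qed.

Lemma is_dcgi_dual_mx (R : comNzRingType) (n : nat) (A B X Y : 'M[R]_n) :
  is_dcgi (dual_mx A B) (dual_mx X Y) ->
  [/\ A *m X *m A = A, A *m (X *m X) = X
    & A *m X *m B + (A *m Y + B *m X) *m A = B].
Proof.
move=> [e f _].
have AXA := mul_dual_mx (A *m X) (A *m Y + B *m X) A B.
have AXX := mul_dual_mx A B (X *m X) (X *m Y + Y *m X).
have e' := etrans (congr1 (mulmx^~ (dual_mx A B)) (mul_dual_mx A B X Y)) AXA.
have f' := etrans (congr1 (mulmx (dual_mx A B)) (mul_dual_mx X Y X Y)) AXX.
have [AXAe Be] := dual_mx_inj _ _ _ _ _ _ _ (etrans (esym e') e).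
by have [AXXe _] := dual_mx_inj _ _ _ _ _ _ _ (etrans (esym f') f).
Qed.

Theorem theorem3p4 (R : realType) (n : nat) (A B : 'M[R]_n) :
  (exists G : 'M[dual R]_n, is_dcgi (dual_mx A B) G) <->
  (index_one A /\
   (1%:M - A *m mp_inv A) *m B *m (1%:M - A *m group_inv A) = 0).
Proof.
have [AXA _ _ _] := mp_invP A.
split=> [[G]|[iA]].
- have [X [Y ->]] := dual_mx_surj _ _ _ G.
  move=> /is_dcgi_dual_mx[e1 e2 f1].
  have iA : index_one A.
    apply/anti_leq; rewrite mxrankM_maxl /=.
    (* Putting [X = A X X] into [A = A X A] gives [A = A A X X A], so the rank of [A] is at most
       that of [A *m A]. *)
    by rewrite -{1}e1 -{1}e2 !mulmxA -!(mulmxA (A *m A)) mxrankM_maxl.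
  split=> //; have [AHA _ AH] := group_invP iA.
  set P := 1%:M - _; set Q := 1%:M - _.
  have PA : P *m A = 0 by rewrite mulmxBl mul1mx AXA subrr.
  have AQ : A *m Q = 0 by rewrite mulmxBr mulmx1 AH mulmxA AHA subrr.
  (* By [f1], [B] is a sum of three products, each with [A] at its left end, killed by [P], or at
     its right end, killed by [Q]. *)
  clearbody P Q; rewrite -f1 !(mulmxDr, mulmxDl) !mulmxA PA !mul0mx !add0r.
  by rewrite -!mulmxA AQ !mulmx0 ?addr0.
- have [AHA _ AH] := group_invP iA.
  move: AXA AHA AH; set X := mp_inv A; set H := group_inv A => AXA AHA AH PBQ.
  set P := 1%:M - A *m X in PBQ.
  pose U := P *m B *m H; pose V := X *m B.
  (* As [A H = H A], the hypothesis [PBQ] reads [P B = P B H A = U A], while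
     [A V = A X B = B - P B]. *)
  have BE : A *m V + U *m A = B.
    move: PBQ; rewrite mulmxBr mulmx1 AH mulmxA => /eqP; rewrite subr_eq0.
    by rewrite /U => /eqP <-; rewrite mulmxBl mul1mx mulmxA addrC subrK.
  have [r [C [D [AE rA fC fD]]]] := full_rank_factorization A.
  have uDC : D *m C \in unitmx by apply: index_one_factor_unit; rewrite -AE.
  have uCC := gram_unitmx_full _ _ _ C fC.
  pose C' := dual_mx C (U *m C); pose D' := dual_mx D (D *m V).
  have -> : dual_mx A B = C' *m D'.
    by rewrite mul_dual_mx mulmxA -(mulmxA U) -AE BE.
  (* The eps-parts supplied here and for [K] are those of [D' *m C'] and [C'^T *m C']. *)
  have [W DCW _] := dual_mx_inverse _ _ _ (D *m (U *m C) + D *m V *m C) uDC.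
  have [K CCK KCC] :=
    dual_mx_inverse _ _ _ (C^T *m (U *m C) + (U *m C)^T *m C) uCC.
  rewrite -!mul_dual_mx in DCW; rewrite -!mul_dual_mx -!tr_dual_mx in CCK KCC.
  by exists (C' *m W *m K *m C'^T); apply: full_rank_core_inverse.
Qed.
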